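(* Let $V$ be a finite-dimensional real vector space and let $c_1,c_2\in\bigwedge^2V$ be such that $(V,c_1,c_2)$ is a direct sum $V=\bigoplus_{j=1}^kV_j$, $c_i=\sum_{j=1}^kc_i^{(j)}$, $c_i^{(j)}\in\bigwedge^2V_j$ ($i=1,2$), of $k$ Kronecker blocks $(V_j,c_1^{(j)},c_2^{(j)})$ with $\dim V_j=2n_j+1$ and $n_1<n_2<\dots<n_k$. Let $J=\{c_\lambda\}_{\lambda\in\mathbb{R}^2}$, $c_\lambda=\lambda_1c_1+\lambda_2c_2$, and let $P_{c_\lambda}$, $L$, $L_j$ and $\Phi_i$ ($i\ge 0$) be as defined in the context. Then $$\Phi_0=\Phi_1=\cdots=\Phi_{n_1}\supset\Phi_{n_1+1}=\Phi_{n_1+2}=\cdots=\Phi_{n_2}\supset\cdots\supset\Phi_{n_{k-1}+1}=\cdots=\Phi_{n_k}\supset\Phi_{n_k+1}=\Phi_{n_k+2}=\cdots=:\Phi_{n_{k+1}},$$ where $$\Phi_{n_j}=\sum_{l<j}L_l\oplus\sum_{l\ge j}V_l,\qquad j=1,\dots,k+1$$ (with the convention $V_l=0$ for $l>k$). In particular, the filtration $\{\Phi_i\}$ is stable for $i>n_k$, $\Phi_{n_k+1}=\bigoplus_{j=1}^kL_j=L$, and the numbers $n_1,\dots,n_k$ are invariants of $J$ (they depend neither on the choice of the decomposition into Kronecker blocks nor on the choice of the pair generating $J$).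
   Context: Kronecker block of dimension $2n+1$ ($n\ge 0$): a vector space with basis $p_1,\dots,p_n,q_1,\dots,q_{n+1}$ together with the pair of bivectors $a_1=\sum_{s=1}^np_s\wedge q_s$, $a_2=\sum_{s=1}^np_s\wedge q_{s+1}$ (for $n=0$, $a_1=a_2=0$). For a bivector $c\in\bigwedge^2V$, $P_c\subset V$ denotes its characteristic subspace, i.e. the image of the associated map $c^\sharp:V^*\to V$ (the symplectic leaf of $c$ through $0$). Put $c_\lambda=\lambda_1c_1+\lambda_2c_2$ and $c_\lambda^{(j)}=\lambda_1c_1^{(j)}+\lambda_2c_2^{(j)}$ for $\lambda=(\lambda_1,\lambda_2)\in\mathbb{R}^2$; $P_{c_\lambda}\subset V$ and $P_{c_\lambda^{(j)}}\subset V_j$ are the corresponding characteristic subspaces; for $\lambda\neq0$ they depend only on the class of $\lambda$ in $\mathbb{P}(\mathbb{R}^2)$. Put $$L=\bigcap_{\lambda\ne0}P_{c_\lambda}\subset V,\qquad L_j=\bigcap_{\lambda\neq0}P_{c_\lambda^{(j)}}\subset V_j,$$ $$\Phi_0=V,\qquad \Phi_i=\sum_{\text{distinct }\lambda_1,\dots,\lambda_i\in\mathbb{P}(\mathbb{R}^2)}P_{c_{\lambda_1}}\cap\dots\cap P_{c_{\lambda_i}}\quad(i\ge1).$$ *)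

(* Defs.v *)
From HB Require Import structures.
From mathcomp Require Import all_boot all_order all_algebra.
From mathcomp Require Import boolp classical_sets reals.

Set Implicit Arguments.
Unset Strict Implicit.
Unset Printing Implicit Defensive.
Import GRing.Theory.
Local Open Scope ring_scope.
Local Open Scope classical_set_scope.

Lemma vspan_subproof (R : fieldType) (V : vectType R) (A : set V) :
  {U : {vspace V} | forall v, v \in U <->
    exists s : seq V, (forall x, x \in s -> A x) /\ v \in <<s>>%VS}.
Proof.
apply: cid.
pose P d := `[< exists s : seq V,
  (forall x, x \in s -> A x) /\ \dim <<s>>%VS = d >].
have P0 : exists d, P d by exists (\dim <<[::] : seq V>>%VS); apply/asboolP; exists [::].
have Pmax d : P d -> (d <= \dim {:V})%N.
  by move=> /asboolP[s [_ <-]]; apply/dimvS/subvf.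
case: (ex_maxnP P0 Pmax) => d /asboolP[s [sA <-]] dmax.
exists <<s>>%VS => v; split=> [vs|[t [tA vt]]]; first by exists s.
have st_s : (<<s ++ t>> <= <<s>>)%VS.
  have sst : (<<s>> <= <<s ++ t>>)%VS by rewrite span_cat addvSl.
  rewrite -(geq_leqif (dimv_leqif_sup sst)); apply: dmax; apply/asboolP.
  by exists (s ++ t); split=> // x; rewrite mem_cat => /orP[/sA|/tA].
by apply: (subvP st_s); rewrite span_cat; apply: (subvP (addvSr _ _)).
Qed.

Definition vspan (R : fieldType) (V : vectType R) (A : set V) : {vspace V} :=
  sval (vspan_subproof A).

Lemma vspanP (R : fieldType) (V : vectType R) (A : set V) (v : V) :
  v \in vspan A <->
  exists s : seq V, (forall x, x \in s -> A x) /\ v \in <<s>>%VS.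
Proof. exact: (svalP (vspan_subproof A)). Qed.

Definition vbigsum (R : fieldType) (V : vectType R) (I : Type) (D : set I)
    (F : I -> {vspace V}) : {vspace V} :=
  vspan (\bigcup_(i in D) [set v | v \in F i]).

(* The set under [vspan] is already a subspace, see [vbigcapP] *)
Definition vbigcap (R : fieldType) (V : vectType R) (I : Type) (D : set I)
    (F : I -> {vspace V}) : {vspace V} :=
  vspan (\bigcap_(i in D) [set v | v \in F i]).

Lemma vbigcapP (R : fieldType) (V : vectType R) (I : Type) (D : set I)
    (F : I -> {vspace V}) (v : V) :
  v \in vbigcap D F <-> (forall i, D i -> v \in F i).
Proof.
split=> [/vspanP[s [sF vs]] i Di|vF].
  by apply: subvP vs; apply/span_subvP => x /sF /(_ i Di).
by apply/vspanP; exists [:: v]; split; rewrite ?memv_span1 // => x;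
  rewrite inE => /eqP->.
Qed.

(* A bivector c is identified with its sharp map, a linear map from the dual
   of V to V; for a decomposable bivector it is
   (u /\ v)^# alpha = alpha(u) v - alpha(v) u.  *)
Definition wedge (R : fieldType) (V : vectType R) (u v : V) :
    'Hom('Hom(V, R^o), V) :=
  linfun (fun alpha : 'Hom(V, R^o) =>
    (alpha u : R) *: v - (alpha v : R) *: u).

Lemma wedgeE (R : fieldType) (V : vectType R) (u v : V)
    (alpha : 'Hom(V, R^o)) :
  wedge u v alpha = (alpha u : R) *: v - (alpha v : R) *: u.
Proof.
pose f (a : 'Hom(V, R^o)) := (a u : R) *: v - (a v : R) *: u.
have f_lin : linear f.
  move=> a x y; rewrite /f !add_lfunE !scale_lfunE !scalerDl scalerBr !scalerA.
  by rewrite opprD addrACA.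
pose fL := GRing.isLinear.Build _ _ _ _ f f_lin.
pose fl : {linear 'Hom(V, R^o) -> V} := HB.pack f fL.
exact: (lfunE fl).
Qed.

(* The exterior square of the subspace U, as a subspace of that of V *)
Definition ext2 (R : fieldType) (V : vectType R) (U : {vspace V}) :
    {vspace 'Hom('Hom(V, R^o), V)} :=
  vspan [set wedge u v | u in [set x | x \in U] & v in [set x | x \in U]].

(* For c in ext2 U the image does not depend on whether c is viewed as a
   bivector on V or on U, because every linear form on U extends to V. *)
Definition charsub (R : fieldType) (V : vectType R)
    (c : 'Hom('Hom(V, R^o), V)) : {vspace V} := limg c.

Definition pencil (R : fieldType) (V : vectType R)
    (c1 c2 : 'Hom('Hom(V, R^o), V)) (l : (R^o * R^o)%type) :
    'Hom('Hom(V, R^o), V) :=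
  (l.1 : R) *: c1 + (l.2 : R) *: c2.

Definition pencil_core (R : fieldType) (V : vectType R)
    (c1 c2 : 'Hom('Hom(V, R^o), V)) : {vspace V} :=
  vbigcap [set l : (R^o * R^o)%type | l != 0]
    (fun l => charsub (pencil c1 c2 l)).

(* Points of the projective line are given by nonzero vectors; two of them
   are the same point when they span the same line. *)
Definition distinct_points (R : fieldType) (i : nat)
    (l : 'I_i -> (R^o * R^o)%type) : Prop :=
  (forall t, l t != 0) /\ injective (fun t => <[l t]>%VS).

Definition Phi (R : fieldType) (V : vectType R)
    (c1 c2 : 'Hom('Hom(V, R^o), V)) (i : nat) : {vspace V} :=
  if i is 0 then fullv else
  vbigsum [set l : 'I_i -> (R^o * R^o)%type | distinct_points l]
    (fun l => \bigcap_(t < i) charsub (pencil c1 c2 (l t)))%VS.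

Definition kronecker_block (R : fieldType) (V : vectType R) (n : nat)
    (U : {vspace V}) (a1 a2 : 'Hom('Hom(V, R^o), V)) : Prop :=
  exists (p : n.-tuple V) (q : n.+1.-tuple V),
    [/\ basis_of U (p ++ q),
        a1 = \sum_(s < n) wedge p`_s q`_s &
        a2 = \sum_(s < n) wedge p`_s q`_s.+1].

Definition kronecker_decomposition (R : fieldType) (V : vectType R)
    (c1 c2 : 'Hom('Hom(V, R^o), V)) (k : nat) (n : 'I_k -> nat)
    (W : 'I_k -> {vspace V}) (d1 d2 : 'I_k -> 'Hom('Hom(V, R^o), V)) : Prop :=
  [/\ directv (\sum_j W j) /\ (\sum_j W j)%VS = fullv,
      forall j, d1 j \in ext2 (W j) /\ d2 j \in ext2 (W j),
      c1 = \sum_j d1 j,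
      c2 = \sum_j d2 j &
      forall j, kronecker_block (n j) (W j) (d1 j) (d2 j)].

(* Main.v *)
Require Import Defs.
From HB Require Import structures.
From mathcomp Require Import all_boot all_order all_algebra.
From mathcomp Require Import boolp classical_sets reals.

Set Implicit Arguments.
Unset Strict Implicit.
Unset Printing Implicit Defensive.
Import Order.TTheory GRing.Theory Num.Theory.
Local Open Scope ring_scope.
Local Open Scope classical_set_scope.

(** In a Kronecker block of dimension 2n+1, read the coordinates along
    q_1, ..., q_(n+1) as the coefficients of a polynomial h of degree at most
    n.  The pencil element with parameter l = (l1, l2) is the sum of the
    wedges of p_s with l1 q_s + l2 q_(s+1), and l1 q_s + l2 q_(s+1) is the
    polynomial (l1 + l2 X) X^(s-1).  Hence, for l nonzero, its characteristic
    subspace is the span of the p_s plus the multiples of the linear form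
    l1 + l2 X, with cofactor of degree at most n-1 ([charsub_block],
    [mem_charsub_block]); a form with l2 = 0 plays the role of the point at
    infinity and only lowers the degree.

    Two facts on polynomials of degree at most n now settle a single block.
    A common multiple of more than n pairwise independent linear forms is zero
    ([linform_multiples_eq0]), so beyond n points only the span of the p_s
    remains, and this span is the core of the block ([mem_core_block]).
    Conversely, each Lagrange polynomial for the n+1 nodes 0, ..., n is
    a multiple of X - m for n of these nodes m, and the Lagrange polynomials
    span, so for i at most n the sum of the i-fold intersections is the whole
    block ([block_subv_Phi]).

    For a direct sum of blocks, composing linear forms with the projection to
    a block separates the blocks, and characteristic subspaces add up
    ([charsub_sum]).  Therefore the i-th term of the filtration is the direct
    sum of the blocks with n_j >= i and of the cores of the other blocks
    ([Phi_sum]), from which every assertion on the filtration is read off.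

    Its dimension drops between i and i+1 by i+1 times the number of blocks
    with n_j = i ([dim_Phi_step]), so the filtration determines the multiset
    of the n_j.  The filtration in turn depends only on the range of the pencil:
    unless the pencil vanishes identically its parametrization is injective
    ([pencil_trivial_or_injective]), and two injective parametrizations of the
    same space differ by a linear bijection of the parameters, which preserves
    distinctness of projective points ([Phi_subv_range]). *)

(** * The image of a sum of wedges *)

Section Pencils.
Variables (F : fieldType) (V : vectType F).
Implicit Types (c : 'Hom('Hom(V, F^o), V)) (l : (F^o * F^o)%type) (h g : {poly F}).

Lemma pencilE c1 c2 l a : pencil c1 c2 l a = (l.1 : F) *: c1 a + (l.2 : F) *: c2 a.
Proof. by rewrite /pencil add_lfunE !scale_lfunE. Qed.

Lemma wedge_comb (p u v : V) (a b : F) :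
  wedge p (a *: u + b *: v) = a *: wedge p u + b *: wedge p v.
Proof.
apply/lfunP => f; rewrite add_lfunE !scale_lfunE !wedgeE (linearD f) !(linearZ_LR f) /=.
rewrite !scalerBr scalerDr (scalerDl p) -!scalerA opprD addrACA.
by rewrite !(scalerA (f p : F)) !scalerA ![(f p : F) * _]mulrC.
Qed.

(** Evaluating at the linear form dual to one vector of the free family
    returns, up to sign, the vector paired with it. *)
Lemma limg_sum_wedge n (p w : n.-tuple V) : free (p ++ w) ->
  limg (\sum_(s < n) wedge p`_s w`_s) = (<<p>> + <<w>>)%VS.
Proof.
move=> free_pw; pose X := [tuple of p ++ w].
have Xl (s : 'I_n) : X`_(lshift n s) = p`_s by rewrite nth_cat size_tuple /= ltn_ord.
have Xr (s : 'I_n) : X`_(rshift n s) = w`_s.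
  by rewrite nth_cat size_tuple /= ltnNge leq_addr addKn.
have ev (i : 'I_(n + n)) (j : 'I_(n + n)) :
    (linfun (coord X i : V -> F^o) : 'Hom(V, F^o)) X`_j = (j == i)%:R.
  by rewrite lfunE /= coord_free.
apply/eqP; rewrite eqEsubv; apply/andP; split.
  apply/subvP => _ /memv_imgP[f _ ->]; rewrite sum_lfunE rpred_sum // => s _.
  rewrite wedgeE rpredB // memvZ //.
    by apply: (subvP (addvSr _ _)); rewrite memv_span ?mem_nth ?size_tuple.
  by apply: (subvP (addvSl _ _)); rewrite memv_span ?mem_nth ?size_tuple.
rewrite -span_cat; apply/span_subvP => x /(tnthP X)[i ->].
rewrite (tnth_nth 0).
case: (split_ordP i) => s ->.
  rewrite Xl; apply/memv_imgP; exists (- linfun (coord X (rshift n s) : V -> F^o)).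
    exact: memvf.
  rewrite linearN /= sum_lfunE (bigD1 s) //= big1 => [|t ts].
    by rewrite wedgeE -Xl -Xr !ev eqxx eq_lrshift scale0r scale1r sub0r addr0 opprK.
  by rewrite wedgeE -Xl -Xr !ev eq_lrshift eq_rshift (negPf ts) !scale0r subrr.
rewrite Xr; apply/memv_imgP; exists (linfun (coord X (lshift n s) : V -> F^o)).
  exact: memvf.
rewrite sum_lfunE (bigD1 s) //= big1 => [|t ts].
  by rewrite wedgeE -Xl -Xr !ev eqxx eq_rlshift scale0r scale1r subr0 addr0.
by rewrite wedgeE -Xl -Xr !ev eq_rlshift eq_lshift (negPf ts) !scale0r subrr.
Qed.

(** * Kronecker blocks as spaces of polynomials *)

Definition polycomb n (s : n.-tuple V) (h : {poly F}) : V :=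
  \sum_(i < n) h`_i *: s`_i.

Lemma polycombB n (s : n.-tuple V) h g :
  polycomb s (h - g) = polycomb s h - polycomb s g.
Proof.
rewrite /polycomb -sumrB; apply: eq_bigr => i _.
by rewrite coefB scalerBl.
Qed.

Lemma polycomb_span n (s : n.-tuple V) h : polycomb s h \in <<s>>%VS.
Proof.
apply: rpred_sum => i _; apply/memvZ/memv_span/mem_nth.
by rewrite size_tuple.
Qed.

Lemma polycomb_poly n (s : n.-tuple V) (k : 'I_n -> F) :
  {h : {poly F} | (size h <= n)%N &
    (forall i : 'I_n, h`_i = k i) /\ polycomb s h = \sum_i k i *: s`_i}.
Proof.
pose E i := if insub i is Some j then k j else 0.
have hE (i : 'I_n) : (\poly_(j < n) E j)`_i = k i.
  by rewrite coef_poly ltn_ord /E valK.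
exists (\poly_(i < n) E i); first exact: size_poly.
by split=> //; apply: eq_bigr => i _; rewrite hE.
Qed.

Lemma span_polycomb n (s : n.-tuple V) v : v \in <<s>>%VS ->
  {h : {poly F} | (size h <= n)%N & v = polycomb s h}.
Proof.
move=> vs; have [h sh [_ hE]] := polycomb_poly s (fun i => coord s i v).
by exists h; rewrite ?hE // {1}(coord_span vs).
Qed.

Lemma polycomb_eq0 n (s : n.-tuple V) h :
  free s -> (size h <= n)%N -> polycomb s h = 0 -> h = 0.
Proof.
move=> /freeP fs sh h0; apply/polyP => i; rewrite coef0.
have [lt_in|le_ni] := ltnP i n; first exact: (fs (fun j => h`_j) h0 (Ordinal lt_in)).
by rewrite nth_default ?(leq_trans sh).
Qed.

(** The homogeneous form l1 Y + l2 X at Y = 1; a point l on the line l2 = 0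
    gives a nonzero constant. *)
Definition linform l : {poly F} := (l.1 : F)%:P + (l.2 : F) *: 'X.

Lemma linform_eq0 l : (linform l == 0) = (l == 0).
Proof.
apply/eqP/eqP => [/polyP l0|->]; last by rewrite /linform scale0r addr0.
case: l l0 => a b l0; have := l0 0%N; have := l0 1%N.
by rewrite !coefE /= !mulr0 !mulr1 add0r addr0 => -> ->.
Qed.

Lemma size_linform_mul l g n :
  (size g <= n)%N -> (size (linform l * g)%R <= n.+1)%N.
Proof.
move=> sg; apply: (leq_trans (size_polyMleq _ _)).
have s2 : (size (linform l) <= 2)%N.
  apply: (leq_trans (size_polyD _ _)); rewrite geq_max.
  rewrite (leq_trans (size_polyC_leq1 _)) //.
  by rewrite (leq_trans (size_scale_leq _ _)) // size_polyX.
by rewrite -subn1 leq_subLR add1n; apply: (leq_add s2 sg).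
Qed.

(** The vectors l1 q_s + l2 q_(s+1) that the pencil element with parameter l
    pairs with the p_s. *)
Definition pencil_tuple n (q : n.+1.-tuple V) l : n.-tuple V :=
  [tuple (l.1 : F) *: q`_s + (l.2 : F) *: q`_s.+1 | s < n].

Lemma nth_pencil_tuple n (q : n.+1.-tuple V) l (s : 'I_n) :
  (pencil_tuple q l)`_s = (l.1 : F) *: q`_s + (l.2 : F) *: q`_s.+1.
Proof. by rewrite -tnth_nth tnth_mktuple. Qed.

(** Multiplication by X shifts q_s to q_(s+1); the bound on g leaves no
    coefficient to be shifted past the last vector. *)
Lemma polycomb_linform n (q : n.+1.-tuple V) l g : (size g <= n)%N ->
  polycomb q (linform l * g) = polycomb (pencil_tuple q l) g.
Proof.
move=> sg; rewrite /polycomb.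
rewrite [RHS](eq_bigr (fun s : 'I_n =>
  ((l.1 : F) * g`_s) *: q`_s + ((l.2 : F) * g`_s) *: q`_s.+1)); last first.
  by move=> s _; rewrite nth_pencil_tuple scalerDr !scalerA ![g`_s * _]mulrC.
rewrite [LHS](eq_bigr (fun s : 'I_n.+1 =>
  ((l.1 : F) * g`_s) *: q`_s + ((l.2 : F) * ('X * g)`_s) *: q`_s)); last first.
  by move=> s _; rewrite mulrDl -scalerAl coefD coefCM coefZ scalerDl.
rewrite !big_split /=; congr (_ + _).
  by rewrite big_ord_recr /= [g`_n]nth_default // mulr0 scale0r addr0.
rewrite big_ord_recl coefXM eqxx mulr0 scale0r add0r.
by apply: eq_bigr => s _; rewrite coefXM.
Qed.

Lemma pencil_block n (p : n.-tuple V) (q : n.+1.-tuple V) l :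
  pencil (\sum_(s < n) wedge p`_s q`_s) (\sum_(s < n) wedge p`_s q`_s.+1) l =
  \sum_(s < n) wedge p`_s (pencil_tuple q l)`_s.
Proof.
rewrite /pencil !scaler_sumr -big_split /=; apply: eq_bigr => s _.
by rewrite nth_pencil_tuple wedge_comb.
Qed.

(** The polynomial ring has no zero divisors, so multiplication by a nonzero
    linear form preserves linear independence. *)
Lemma pencil_tuple_free n (p : n.-tuple V) (q : n.+1.-tuple V) l :
  free (p ++ q) -> l != 0 -> free (p ++ pencil_tuple q l).
Proof.
rewrite !cat_free => /and3P[fp fq /directv_addP dpq] l0; apply/and3P; split=> //.
  apply/freeP => k k0; have [h sh [hk hE]] := polycomb_poly (pencil_tuple q l) k.
  move=> i; rewrite -hk.
  have /eqP : linform l * h = 0.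
    by apply: (polycomb_eq0 fq); rewrite ?size_linform_mul ?polycomb_linform ?hE.
  by rewrite mulf_eq0 linform_eq0 (negPf l0) => /eqP->; rewrite coef0.
apply/directv_addP/eqP; rewrite -subv0 -dpq capvS //.
apply/subvP => v /span_polycomb[h sh ->].
by rewrite -polycomb_linform ?polycomb_span.
Qed.

Lemma charsub_block n (p : n.-tuple V) (q : n.+1.-tuple V) l :
  free (p ++ q) -> l != 0 ->
  charsub (pencil (\sum_(s < n) wedge p`_s q`_s)
                  (\sum_(s < n) wedge p`_s q`_s.+1) l) =
  (<<p>> + <<pencil_tuple q l>>)%VS.
Proof.
move=> fpq l0; rewrite /charsub pencil_block.
exact/limg_sum_wedge/pencil_tuple_free.
Qed.

(** Intersecting characteristic subspaces becomes a question of common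
    multiples of linear forms. *)
Lemma mem_charsub_block n (p : n.-tuple V) (q : n.+1.-tuple V) l u h :
    free (p ++ q) -> l != 0 -> u \in <<p>>%VS -> (size h <= n.+1)%N ->
  u + polycomb q h \in (<<p>> + <<pencil_tuple q l>>)%VS <->
  exists2 g : {poly F}, (size g <= n)%N & h = linform l * g.
Proof.
move=> fpq l0 up sh; split=> [/memv_addP[u' u'p [w]]|[g sg ->]]; last first.
  by rewrite polycomb_linform // memv_add // polycomb_span.
move=> /span_polycomb[g sg ->]; rewrite -polycomb_linform // => E.
exists g => //; apply/eqP; rewrite -subr_eq0; apply/eqP.
move: fpq; rewrite cat_free => /and3P[_ fq /directv_addP dpq].
apply: (polycomb_eq0 fq).
  rewrite (leq_trans (size_polyD _ _)) // geq_max sh size_polyN.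
  exact: size_linform_mul.
apply/eqP; rewrite -memv0 -dpq memv_cap polycomb_span andbT.
rewrite polycombB.
have -> : polycomb q h - polycomb q (linform l * g) = u' - u.
  by rewrite -[polycomb q h](addKr u) E addrA addrK addrC.
by rewrite rpredB.
Qed.

(** A form with l2 nonzero contributes the root - l1 / l2.  At most one of the
    points satisfies l2 = 0; it contributes no root but lowers the degree
    bound by one.  In all cases h has at least as many distinct roots as the
    bound on its size, so it vanishes. *)
Lemma linform_multiples_eq0 n i (l : 'I_i -> (F^o * F^o)%type) h :
    distinct_points l -> (n < i)%N -> (size h <= n.+1)%N ->
  (forall t, exists2 g : {poly F}, (size g <= n)%N & h = linform (l t) * g) -> h = 0.
Proof.
move=> [l0 linj] ni sh hl.
have line_inj t t' (k : F) : k != 0 -> l t = k *: l t' -> t = t'.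
  move=> k0 E; apply: linj; apply/eqP; rewrite eqEsubv -!memvE.
  have E' : l t' = k^-1 *: l t by rewrite E scalerA mulVf ?scale1r.
  apply/andP; split.
    by rewrite E memvZ ?memv_line.
  by rewrite E' memvZ ?memv_line.
pose A := [pred t | (l t).2 != 0].
pose rs := [seq - ((l t).1 : F) / (l t).2 | t in A].
have rootA : all (root h) rs.
  apply/allP => x /mapP[t]; rewrite mem_enum inE => l2 ->; have [g _ ->] := hl t.
  rewrite rootM; apply/orP; left; apply/rootP.
  by rewrite !hornerE /= mulrAC divff // mul1r addrN.
have uniq_rs : uniq rs.
  rewrite map_inj_in_uniq ?enum_uniq // => t t'; rewrite !mem_enum => At At' E.
  apply: (@line_inj _ _ ((l t).2 / (l t').2 : F)).
    by rewrite mulf_neq0 ?invr_neq0.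
  move: At At' E; rewrite !inE; case: (l t) (l t') => a b [a' b'] /= b0 b'0 E.
  apply: injective_projections; rewrite /= -[RHS]/(_ * _) ?divfK //.
  move/(congr1 (fun x => - x * b)): E; rewrite !mulNr !opprK divfK // => ->.
  by rewrite mulrAC [a' * b]mulrC mulrAC.
apply: (roots_geq_poly_eq0 rootA uniq_rs).
rewrite size_map -cardE.
have := cardC A; rewrite card_ord => cA.
have [/eqP C0|] := boolP (#|[predC A]| == 0%N).
  by move: cA; rewrite C0 addn0 => ->; apply: leq_trans ni.
rewrite -lt0n => /card_gt0P[t At].
(* Two points with l2 = 0 are proportional. *)
have C1 : (#|[predC A]| <= 1)%N.
  apply: (@leq_trans #|pred1 t|); last by rewrite card1.
  apply/subset_leq_card/fintype.subsetP => t' At'; rewrite inE; apply/eqP.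
  move: At At' (l0 t) (l0 t') (@line_inj t' t); rewrite !inE !negbK.
  case: (l t) (l t') => a b [a' b'] /= /eqP-> /eqP-> a0 a'0 H.
  have {}a0 : a != 0 by apply: contraNneq a0 => ->.
  have {}a'0 : a' != 0 by apply: contraNneq a'0 => ->.
  apply: (H (a' / a : F)); first by rewrite mulf_neq0 ?invr_neq0.
  by apply: injective_projections; rewrite /= -[RHS]/(_ * _) ?divfK ?mulr0.
(* Here the linear form is a constant, and the cofactor has size at most n. *)
have sn : (size h <= n)%N.
  have [g sg ->] := hl t; move: At; rewrite !inE negbK => /eqP l20.
  by rewrite /linform l20 scale0r addr0 mul_polyC (leq_trans (size_scale_leq _ _)).
apply: (leq_trans sn); rewrite -ltnS.
apply: (leq_trans (leq_trans ni (eq_leq (esym cA)))).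
by rewrite -addn1 leq_add2l.
Qed.

(** * Membership in the filtration *)

Lemma mem_vspan (A : set V) v : A v -> v \in vspan A.
Proof.
move=> Av; apply/vspanP; exists [:: v]; rewrite memv_span1; split=> // x.
by rewrite inE => /eqP->.
Qed.

Lemma vspan_subv (A : set V) (U : {vspace V}) :
  (forall v, A v -> v \in U) -> (vspan A <= U)%VS.
Proof.
move=> AU; apply/subvP => v /vspanP[s [sA]]; apply/subvP/span_subvP => x.
by move/sA/AU.
Qed.

Lemma core_subv_charsub c1 c2 l :
  l != 0 -> (pencil_core c1 c2 <= charsub (pencil c1 c2 l))%VS.
Proof. by move=> l0; apply/subvP => v /vbigcapP; apply. Qed.

Lemma mem_Phi c1 c2 i (l : 'I_i -> (F^o * F^o)%type) v : distinct_points l ->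
  (forall t, v \in charsub (pencil c1 c2 (l t))) -> v \in Phi c1 c2 i.
Proof.
case: i l => [|i] l dl vl; first exact: memvf.
apply: mem_vspan; exists l => //=.
by rewrite memvE; apply/subv_bigcapP => t _; rewrite -memvE.
Qed.

Lemma Phi_subv c1 c2 i (U : {vspace V}) :
    (forall (l : 'I_i.+1 -> (F^o * F^o)%type) v, distinct_points l ->
      (forall t, v \in charsub (pencil c1 c2 (l t))) -> v \in U) ->
  (Phi c1 c2 i.+1 <= U)%VS.
Proof.
move=> PU; apply: vspan_subv => v [l dl /= vl]; apply: (PU l) => // t.
by move: vl; rewrite memvE => /subv_bigcapP/(_ t isT); rewrite -memvE.
Qed.

(** * The filtration of a single block *)

Lemma block_span n (p : n.-tuple V) (q : n.+1.-tuple V) (U : {vspace V}) v :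
    basis_of U (p ++ q) -> v \in U ->
  exists u h, [/\ u \in <<p>>%VS, (size (h : {poly F}) <= n.+1)%N &
                 v = u + polycomb q h].
Proof.
move=> /span_basis <-; rewrite span_cat => /memv_addP[u up [w]].
by move=> /span_polycomb[h sh ->] ->; exists u, h.
Qed.

Lemma charsub_block_subv n (U : {vspace V}) a1 a2 l :
  kronecker_block n U a1 a2 -> l != 0 -> (charsub (pencil a1 a2 l) <= U)%VS.
Proof.
move=> [p [q [bU -> ->]]] l0; rewrite charsub_block ?(basis_free bU) //.
rewrite -(span_basis bU) span_cat addvS //.
by apply/subvP => v /span_polycomb[g sg ->]; rewrite -polycomb_linform ?polycomb_span.
Qed.

Lemma span_mem_core_block n (p : n.-tuple V) (q : n.+1.-tuple V) v :
  free (p ++ q) -> v \in <<p>>%VS ->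
  v \in pencil_core (\sum_(s < n) wedge p`_s q`_s)
                    (\sum_(s < n) wedge p`_s q`_s.+1).
Proof.
move=> fpq vp; apply/vbigcapP => l /= l0.
by rewrite charsub_block // (subvP (addvSl _ _)).
Qed.

Lemma mem_charsubs_span n (p : n.-tuple V) (q : n.+1.-tuple V) i
    (l : 'I_i -> (F^o * F^o)%type) v :
    free (p ++ q) -> distinct_points l -> (n < i)%N ->
    (forall t, v \in charsub (pencil (\sum_(s < n) wedge p`_s q`_s)
                                     (\sum_(s < n) wedge p`_s q`_s.+1) (l t))) ->
  v \in <<p>>%VS.
Proof.
move=> fpq dl ni vl; pose U := <<p ++ q>>%VS.
have bU : basis_of U (p ++ q) by rewrite /basis_of eqxx.
have kU : kronecker_block n U (\sum_(s < n) wedge p`_s q`_s)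
                              (\sum_(s < n) wedge p`_s q`_s.+1) by exists p, q.
have vU : v \in U.
  have t : 'I_i by case: i ni {l dl vl} => // i _; exact: ord0.
  by apply: (subvP (charsub_block_subv kU _)) (vl t); case: dl.
have [u [h [up sh vE]]] := block_span bU vU.
suff h0 : h = 0 by rewrite vE h0 /polycomb big1 ?addr0 // => s _; rewrite coef0 scale0r.
apply: (linform_multiples_eq0 dl ni sh) => t.
have lt0 : l t != 0 by case: dl.
by apply/(mem_charsub_block fpq lt0 up sh); rewrite -vE -charsub_block.
Qed.

End Pencils.

Section InfiniteField.
Variables (F : numFieldType) (V : vectType F).
Implicit Types (c : 'Hom('Hom(V, F^o), V)) (h g : {poly F}).

(** The parameter whose linear form is X - m, so that the natural numbers give
    as many distinct points as needed. *)
Definition affine_point (m : nat) : (F^o * F^o)%type := (- m%:R, 1).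

Lemma affine_point_neq0 m : affine_point m != 0.
Proof. by apply/eqP => -[_ /eqP]; rewrite oner_eq0. Qed.

Lemma linform_affine_point m : linform (affine_point m) = 'X - m%:R%:P.
Proof. by rewrite /linform /= scale1r polyCN addrC. Qed.

Lemma distinct_affine_points i (f : 'I_i -> nat) :
  injective f -> distinct_points (fun t => affine_point (f t)).
Proof.
move=> f_inj; split=> [t|t t' /= E]; first exact: affine_point_neq0.
have : affine_point (f t) \in <[affine_point (f t')]>%VS by rewrite -E memv_line.
move=> /vlineP[k [Ex Ek]]; apply: f_inj; apply/eqP.
by move: Ek Ex; rewrite /GRing.scale /= mulr1 => <-; rewrite mul1r => /oppr_inj/eqP;
  rewrite eqr_nat.
Qed.

Lemma core_block_eq n (p : n.-tuple V) (q : n.+1.-tuple V) :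
  free (p ++ q) ->
  pencil_core (\sum_(s < n) wedge p`_s q`_s)
              (\sum_(s < n) wedge p`_s q`_s.+1) = <<p>>%VS.
Proof.
move=> fpq; apply/eqP; rewrite eqEsubv; apply/andP; split; apply/subvP => v; last first.
  exact: span_mem_core_block.
move/vbigcapP => vl.
have dl := distinct_affine_points (val_inj : injective (val : 'I_n.+1 -> nat)).
by apply: (mem_charsubs_span fpq dl) => // t; apply/vl/affine_point_neq0.
Qed.

Lemma dim_core_block n (U : {vspace V}) a1 a2 :
  kronecker_block n U a1 a2 -> \dim (pencil_core a1 a2) = n.
Proof.
move=> [p [q [/basis_free fpq -> ->]]]; rewrite core_block_eq //.
by apply/eqP; move: fpq; rewrite cat_free => /and3P[]; rewrite /free size_tuple.
Qed.

Lemma dim_block n (U : {vspace V}) a1 a2 :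
  kronecker_block n U a1 a2 -> \dim U = n.*2.+1.
Proof.
by move=> [p [q [/(@size_basis _ _ _ _ [tuple of p ++ q]) -> _ _]]]; rewrite addnS addnn.
Qed.

Lemma core_subv_Phi c1 c2 i : (pencil_core c1 c2 <= Phi c1 c2 i)%VS.
Proof.
apply/subvP => v /vbigcapP vl.
have dl := distinct_affine_points (val_inj : injective (val : 'I_i -> nat)).
by apply: (mem_Phi dl) => t; apply/vl/affine_point_neq0.
Qed.

Lemma mem_core_block n (U : {vspace V}) a1 a2 i (l : 'I_i -> (F^o * F^o)%type) v :
    kronecker_block n U a1 a2 -> distinct_points l -> (n < i)%N ->
    (forall t, v \in charsub (pencil a1 a2 (l t))) ->
  v \in pencil_core a1 a2.
Proof.
move=> [p [q [/basis_free fpq -> ->]]] dl ni vl; rewrite core_block_eq //.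
exact: (mem_charsubs_span fpq dl ni vl).
Qed.

(** It suffices to reach each Lagrange polynomial for the nodes 0, ..., n: it
    has n of the nodes as roots, hence lies in the intersection over any i of
    the corresponding n points. *)
Lemma block_subv_Phi n (U : {vspace V}) a1 a2 i :
  kronecker_block n U a1 a2 -> (i <= n)%N -> (U <= Phi a1 a2 i)%VS.
Proof.
move=> kU le_in; have [p [q [bU a1E a2E]]] := kU; have fpq := basis_free bU.
apply/subvP => v /(block_span bU)[u [h [up sh ->]]]; apply: rpredD.
  apply: (subvP (core_subv_Phi _ _ _)).
  by rewrite a1E a2E span_mem_core_block.
have xinj : injective (fun m : nat => m%:R : F).
  by move=> x y /eqP; rewrite eqr_nat => /eqP.
rewrite (lagrange_gen (ltn0Sn n) xinj sh).
have -> g : polycomb q g = \sum_(s < n.+1) g`_s *: q`_s by [].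
rewrite (eq_bigr (fun s : 'I_n.+1 => \sum_(m < n.+1)
   (h.[m%:R] * (tnth (lagrange n.+1 (fun m : nat => m%:R : F)) m : {poly F})`_s)
     *: q`_s)); last first.
  move=> s _; rewrite coef_sum scaler_suml; apply: eq_bigr => m _.
  by rewrite coefCM.
rewrite exchange_big rpred_sum // => m _ /=.
rewrite (eq_bigr _ (fun s _ => esym (scalerA _ _ _))) -scaler_sumr rpredZ //.
(* lift m enumerates the nodes other than m; the first i of them are used. *)
have widen_lift_inj : injective (fun t : 'I_i => lift m (widen_ord le_in t) : nat).
  by move=> t t' /val_inj/lift_inj/(congr1 val)/= /val_inj.
have dl := distinct_affine_points widen_lift_inj.
apply: (mem_Phi dl) => t; set x := lift m _.
rewrite a1E a2E charsub_block ?affine_point_neq0 //.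
rewrite -[X in X \in _]add0r; apply/(mem_charsub_block fpq) => //.
- exact: affine_point_neq0.
- exact: mem0v.
set g := tnth _ _.
have : root g x%:R.
  by rewrite /root lagrange_sample // (negPf (neq_lift _ _)).
move/factor_theorem => [f gE]; exists f; last by rewrite linform_affine_point mulrC.
have : size g = n.+1 by rewrite size_lagrange_.
rewrite gE; have [->|f0] := eqVneq f 0; first by rewrite size_poly0.
by rewrite size_Mmonic ?monicXsubC // size_XsubC addn2 => -[->].
Qed.

End InfiniteField.

(** * Direct sums of subspaces *)

Lemma directv_sum_subv (F : fieldType) (V : vectType F) (I : finType)
    (U W : I -> {vspace V}) :
    (forall j, U j <= W j)%VS -> directv (\sum_j W j) ->
  directv (\sum_j U j).
Proof.
move=> UW /directv_sum_independent dW; apply/directv_sum_independent => us usU us0.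
by apply: dW => // j _; apply: (subvP (UW j)); apply: usU.
Qed.

(** This makes the value of a bivector on U at a linear form depend only on the
    restriction of the form to U. *)
Lemma ext2_eq0 (F : fieldType) (V : vectType F) (U : {vspace V}) c
    (f : 'Hom(V, F^o)) :
  c \in ext2 U -> (forall u, u \in U -> f u = 0) -> c f = 0.
Proof.
move=> /vspanP[s [sU cs]] f0; rewrite (coord_span (cs : c \in <<in_tuple s>>%VS)).
rewrite sum_lfunE big1 // => i _; rewrite scale_lfunE.
have /sU[u /= uU [v /= vU <-]] : (in_tuple s)`_i \in s by rewrite mem_nth.
by rewrite wedgeE !f0 // !scale0r subrr scaler0.
Qed.

Section DirectSum.
Variables (F : fieldType) (V : vectType F) (I : finType) (W : I -> {vspace V}).
Hypotheses (dW : directv (\sum_j W j)) (fW : fullv = (\sum_j W j)%VS).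

Definition proj j : 'End(V) := sumv_pi_for fW j.

Lemma proj_mem j v : proj j v \in W j.
Proof. exact: memv_sum_pi. Qed.

Lemma sum_proj v : \sum_j proj j v = v.
Proof. by apply: sumv_pi_sum; apply: memvf. Qed.

Lemma proj_sum (u : I -> V) j : (forall i, u i \in W i) -> proj j (\sum_i u i) = u j.
Proof.
move=> uW; have /directv_sum_unique/(_ (fun i => proj i (\sum_i u i)) u) := dW.
move=> /(_ (fun i _ => proj_mem _ _) (fun i _ => uW i)).
by rewrite sum_proj eqxx => /esym/forallP/(_ j)/eqP.
Qed.

Lemma proj_summand i j v : v \in W j -> proj i v = if i == j then v else 0.
Proof.
move=> vW; pose u m := if m == j then v else 0.
have uW m : u m \in W m by rewrite /u; case: eqP => [->|]; rewrite ?mem0v.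
have vE : v = \sum_m u m.
  by rewrite (bigD1 j) //= {1}/u eqxx big1 ?addr0 // /u => m /negPf->.
by rewrite {1}vE proj_sum.
Qed.

Lemma mem_sum_proj (U : I -> {vspace V}) v :
    (forall j, U j <= W j)%VS ->
  v \in (\sum_j U j)%VS <-> (forall j, proj j v \in U j).
Proof.
move=> UW; split=> [/memv_sumP[u uU ->] j|Uv].
  by rewrite proj_sum ?uU // => i; apply: (subvP (UW i)); apply: uU.
by rewrite -(sum_proj v) memv_sumr.
Qed.
End DirectSum.

(** * Decompositions into Kronecker blocks *)

Section Decomposition.
Variables (F : numFieldType) (V : vectType F) (c1 c2 : 'Hom('Hom(V, F^o), V)).
Variables (k : nat) (n : 'I_k -> nat) (W : 'I_k -> {vspace V}).
Variables (d1 d2 : 'I_k -> 'Hom('Hom(V, F^o), V)).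
Hypothesis dec : kronecker_decomposition c1 c2 n W d1 d2.

Let dW : directv (\sum_j W j). Proof. by case: dec => -[]. Qed.
Let fW : fullv = (\sum_j W j)%VS. Proof. by case: dec => -[_ ->]. Qed.
Let kW j : kronecker_block (n j) (W j) (d1 j) (d2 j).
Proof. by case: dec => _ _ _ _; apply. Qed.

Lemma pencil_sum l : pencil c1 c2 l = \sum_j pencil (d1 j) (d2 j) l.
Proof.
by case: dec => _ _ -> -> _; rewrite /pencil !scaler_sumr -big_split.
Qed.

(** The composite with the projection agrees with f on the j-th block and
    vanishes on the others, so only the j-th summand sees it. *)
Lemma pencil_proj l j (f : 'Hom(V, F^o)) :
  pencil c1 c2 l (f \o proj fW j)%VF = pencil (d1 j) (d2 j) l f.
Proof.
have [_ dext _ _ _] := dec.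
have ext0 i (g : 'Hom(V, F^o)) : (forall u, u \in W i -> g u = 0) ->
    pencil (d1 i) (d2 i) l g = 0.
  move=> g0; rewrite pencilE; have [e1 e2] := dext i.
  by rewrite (ext2_eq0 e1 g0) (ext2_eq0 e2 g0) !scaler0 addr0.
rewrite pencil_sum sum_lfunE (bigD1 j) //= big1 ?addr0 => [|i ij]; last first.
  by apply: ext0 => u uW; rewrite comp_lfunE (proj_summand dW _ _ uW)
    eq_sym (negPf ij) linear0.
apply/eqP; rewrite -subr_eq0 -linearB; apply/eqP/ext0 => u uW.
by rewrite add_lfunE opp_lfunE comp_lfunE (proj_summand dW _ _ uW) eqxx subrr.
Qed.

Lemma charsub_sum l :
  charsub (pencil c1 c2 l) = (\sum_j charsub (pencil (d1 j) (d2 j) l))%VS.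
Proof.
apply/eqP; rewrite eqEsubv; apply/andP; split.
  apply/subvP => _ /memv_imgP[f _ ->]; rewrite pencil_sum sum_lfunE.
  by apply: memv_sumr => j _; apply/memv_img/memvf.
apply/subv_sumP => j _; apply/subvP => _ /memv_imgP[f _ ->].
by rewrite -pencil_proj; apply/memv_img/memvf.
Qed.

Lemma mem_charsub l v : l != 0 -> v \in charsub (pencil c1 c2 l) <->
  (forall j, proj fW j v \in charsub (pencil (d1 j) (d2 j) l)).
Proof.
move=> l0; rewrite charsub_sum; apply: mem_sum_proj => // j.
exact: charsub_block_subv (kW j) l0.
Qed.

Lemma core_subv j : (pencil_core (d1 j) (d2 j) <= W j)%VS.
Proof.
have p0 := affine_point_neq0 F 0.
by apply: (subv_trans (core_subv_charsub _ _ p0)); apply: charsub_block_subv (kW j) p0.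
Qed.

Lemma core_sum : pencil_core c1 c2 = (\sum_j pencil_core (d1 j) (d2 j))%VS.
Proof.
apply/vspaceP => v; apply/idP/idP => [/vbigcapP vc|].
  apply/(mem_sum_proj dW fW _ core_subv) => j; apply/vbigcapP => l /= l0.
  by move: j; apply/mem_charsub/vc.
move=> /(mem_sum_proj dW fW _ core_subv) vc; apply/vbigcapP => l /= l0.
by apply/mem_charsub => // j; have /vbigcapP := vc j; apply.
Qed.

Definition Phi_summand i j : {vspace V} :=
  if (i <= n j)%N then W j else pencil_core (d1 j) (d2 j).

Lemma Phi_summand_subv i j : (Phi_summand i j <= W j)%VS.
Proof. by rewrite /Phi_summand; case: ifP => // _; apply: core_subv. Qed.

Lemma Phi_summand_directv i : directv (\sum_j Phi_summand i j).
Proof. exact: directv_sum_subv (Phi_summand_subv i) dW. Qed.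

(** Projecting to a block turns an i-fold intersection for the whole pencil
    into one for the block, where [mem_core_block] applies; the reverse
    inclusion holds summand by summand, because the characteristic subspaces of
    a block lie in those of the whole pencil. *)
Lemma Phi_sum i : Phi c1 c2 i = (\sum_j Phi_summand i j)%VS.
Proof.
case: i => [|i]; first by rewrite /= fW; apply: eq_bigr.
apply/eqP; rewrite eqEsubv; apply/andP; split.
  apply: Phi_subv => l v dl vl; have [l0 _] := dl.
  apply/(mem_sum_proj dW fW _ (Phi_summand_subv _)) => j; rewrite /Phi_summand.
  case: ltnP => [_|ni]; first exact: proj_mem.
  apply: (mem_core_block (kW j) dl ni) => t.
  by move: j {ni}; apply/mem_charsub.
apply/subv_sumP => j _; apply: (@subv_trans _ _ (Phi (d1 j) (d2 j) i.+1)).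
  rewrite /Phi_summand; case: ltnP => [ni|_]; last exact: core_subv_Phi.
  exact: block_subv_Phi (kW j) ni.
apply: Phi_subv => l v dl vl; apply: (mem_Phi dl) => t.
by rewrite charsub_sum; apply: (subvP (sumv_sup j _ _)) (vl t).
Qed.

(** A block has dimension 2 n_j + 1 and its core has dimension n_j. *)
Lemma dim_Phi i :
  \dim (Phi c1 c2 i) = (\sum_j n j + \sum_(j | (i <= n j)%N) (n j).+1)%N.
Proof.
rewrite Phi_sum (directvP (Phi_summand_directv i)) /= [X in (_ + X)%N]big_mkcond.
rewrite -big_split; apply: eq_bigr => j _; rewrite /Phi_summand.
case: ifP => _; first by rewrite (dim_block (kW j)) -addnn -addnS.
by rewrite (dim_core_block (kW j)) /= addn0.
Qed.

Lemma dim_Phi_step i :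
  \dim (Phi c1 c2 i) = (\dim (Phi c1 c2 i.+1) + #|[pred j | n j == i]| * i.+1)%N.
Proof.
rewrite !dim_Phi -addnA; congr (_ + _)%N.
rewrite (bigID (fun j => n j == i)) /= addnC; congr (_ + _)%N.
  by apply: eq_bigl => j; rewrite ltn_neqAle eq_sym andbC.
rewrite (eq_bigl (fun j => n j == i)) => [|j]; last first.
  by case: eqP => [->|]; rewrite ?leqnn ?andbF.
by rewrite -sum_nat_const; apply: eq_bigr => j /eqP->.
Qed.

(** Blocks with n_j = 0 carry the zero pencil, whereas for n_j > 0 every
    characteristic subspace contains the nonzero core of the block.  In
    particular the two bivectors never span a line. *)
Lemma pencil_trivial_or_injective :
  (c1 = 0 /\ c2 = 0) \/ (forall l, pencil c1 c2 l = 0 -> l = 0).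
Proof.
have [j nj|n0] := pickP (fun j => 0 < n j)%N.
  right=> l pl; apply/eqP; apply: contraLR nj => l0.
  rewrite lt0n negbK -(dim_core_block (kW j)) dimv_eq0 -subv0.
  have <- : charsub (pencil c1 c2 l) = 0%VS by rewrite pl /charsub lim0g.
  apply: (subv_trans (core_subv_charsub _ _ l0)).
  by rewrite charsub_sum; apply: sumv_sup.
have absurd j (A : Prop) : 'I_(n j) -> A.
  by move=> s; have := n0 j; rewrite /= (leq_ltn_trans (leq0n s) (ltn_ord s)).
left; have [_ _ -> -> _] := dec; split; apply: big1 => j _.
  have [p [q [_ -> _]]] := kW j; apply: big1 => s _.
  exact: absurd s.
have [p [q [_ _ ->]]] := kW j; apply: big1 => s _.
exact: absurd s.
Qed.

End Decomposition.

(** * Dependence on the range of the pencil *)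

Section RangeInvariance.
Variables (F : fieldType) (V : vectType F).
Implicit Types (c : 'Hom('Hom(V, F^o), V)).

Lemma pencil_linear c1 c2 : linear (pencil c1 c2).
Proof.
move=> a [x1 x2] [y1 y2].
by rewrite /pencil /= !scalerDl scalerDr !scalerA addrACA.
Qed.

Lemma pencil0 c1 c2 : pencil c1 c2 0 = 0.
Proof. by rewrite /pencil /= !scale0r addr0. Qed.

(** Each parameter l of the first pencil has a parameter m of the second one
    with the same value; injectivity makes m nonzero, and sends distinct
    projective points to distinct ones. *)
Lemma Phi_subv_range c1 c2 c1' c2' i :
    (forall l, pencil c1 c2 l = 0 -> l = 0) ->
    (forall l, pencil c1' c2' l = 0 -> l = 0) ->
    range (pencil c1 c2) = range (pencil c1' c2') ->
  (Phi c1 c2 i <= Phi c1' c2' i)%VS.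
Proof.
move=> inj inj' rE.
have sol l : {m | pencil c1' c2' m = pencil c1 c2 l}.
  have : range (pencil c1' c2') (pencil c1 c2 l) by rewrite -rE; exists l.
  by move=> H; apply: cid; case: H => m _ <-; exists m.
case: i => [|i] //; apply: Phi_subv => l v [l0 linj] vl.
pose m t := sval (sol (l t)).
have mE t : pencil c1' c2' (m t) = pencil c1 c2 (l t) := svalP (sol (l t)).
apply: (@mem_Phi _ _ _ _ _ m) => [|t]; last by rewrite mE.
have line (t t' : 'I_i.+1) : <[m t]>%VS = <[m t']>%VS -> (<[l t]> <= <[l t']>)%VS.
  move=> E; have : m t \in <[m t']>%VS by rewrite -E memv_line.
  move=> /vlineP[a ma]; rewrite -memvE; apply/vlineP; exists a.
  apply/eqP; rewrite -subr_eq0; apply/eqP/inj.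
  have -> : l t - a *: l t' = - a *: l t' + l t by rewrite scaleNr addrC.
  rewrite pencil_linear -!mE ma -[a *: m t']addr0 pencil_linear.
  by rewrite pencil0 addr0 scaleNr addNr.
split=> [t|t t' /= E].
  by apply: contra_neq (l0 t) => m0; apply: inj; rewrite -mE m0 pencil0.
by apply: linj; apply/eqP; rewrite eqEsubv !line.
Qed.

End RangeInvariance.

Lemma Phi_pencil (F : fieldType) (V : vectType F)
    (c1 c2 c1' c2' : 'Hom('Hom(V, F^o), V)) i :
  (forall l, pencil c1 c2 l = pencil c1' c2' l) -> Phi c1 c2 i = Phi c1' c2' i.
Proof. by move=> /funext E; case: i => //= i; rewrite E. Qed.

Lemma pencil_eq0_range (F : fieldType) (V : vectType F)
    (c1 c2 : 'Hom('Hom(V, F^o), V)) l :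
  range (pencil 0 0) = range (pencil c1 c2) -> pencil c1 c2 l = 0.
Proof.
move=> rE; have : range (pencil c1 c2) (pencil c1 c2 l) by exists l.
by rewrite -rE => -[m _ <-]; rewrite /pencil !scaler0 addr0.
Qed.

Lemma Phi_range (F : numFieldType) (V : vectType F)
    (c1 c2 c1' c2' : 'Hom('Hom(V, F^o), V)) k n W d1 d2 k' n' W' d1' d2' i :
    @kronecker_decomposition F V c1 c2 k n W d1 d2 ->
    @kronecker_decomposition F V c1' c2' k' n' W' d1' d2' ->
    range (pencil c1' c2') = range (pencil c1 c2) ->
  Phi c1' c2' i = Phi c1 c2 i.
Proof.
move=> dec dec' rE.
have pencil00 l : pencil (0 : 'Hom('Hom(V, F^o), V)) 0 l = 0.
  by rewrite /pencil !scaler0 addr0.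
have [[c10 c20]|inj] := pencil_trivial_or_injective dec.
  move: rE; rewrite c10 c20 => rE; apply: Phi_pencil => l.
  by rewrite pencil00; apply: pencil_eq0_range.
have [[c10 c20]|inj'] := pencil_trivial_or_injective dec'.
  move: rE; rewrite c10 c20 => rE; apply: Phi_pencil => l.
  by rewrite pencil00; apply/esym/pencil_eq0_range.
by apply/eqP; rewrite eqEsubv !Phi_subv_range.
Qed.

(** * The theorem *)

Lemma perm_eq_codom_card (I J : finType) (m : I -> nat) (n : J -> nat) :
    (forall x, #|[pred i | m i == x]| = #|[pred j | n j == x]|) ->
  perm_eq [seq m i | i : I] [seq n j | j : J].
Proof.
move=> mn; apply/allP => x _ /=; rewrite !count_map; apply/eqP.
by rewrite -!size_filter -!enumT; move: (mn x); rewrite !cardE !enumT /enum_mem -!enumT.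
Qed.

Lemma eq_Phi (F : numFieldType) (V : vectType F)
    (c1 c2 : 'Hom('Hom(V, F^o), V)) k n W d1 d2 i i' :
    @kronecker_decomposition F V c1 c2 k n W d1 d2 ->
    (forall l, (i <= n l)%N = (i' <= n l)%N) ->
  Phi c1 c2 i = Phi c1 c2 i'.
Proof.
move=> dec ii'; rewrite !(Phi_sum dec); apply: eq_bigr => l _.
by rewrite /Phi_summand ii'.
Qed.

Lemma Phi_decr (F : numFieldType) (V : vectType F)
    (c1 c2 : 'Hom('Hom(V, F^o), V)) k n W d1 d2 i :
    @kronecker_decomposition F V c1 c2 k n W d1 d2 ->
  (Phi c1 c2 i.+1 <= Phi c1 c2 i)%VS.
Proof.
move=> dec; rewrite !(Phi_sum dec); apply/subv_sumP => j _.
apply: subv_trans (sumv_sup j _ (subvv _)) => //; rewrite /Phi_summand.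
case: ltnP => [/ltnW-> //|_]; case: ifP => // _.
exact: core_subv dec j.
Qed.

Theorem theorem2p1 (R : realType) (V : vectType R)
    (c1 c2 : 'Hom('Hom(V, R^o), V))
    (hc1 : c1 \in ext2 fullv) (hc2 : c2 \in ext2 fullv)
    (k : nat) (n : 'I_k.+1 -> nat) (W : 'I_k.+1 -> {vspace V})
    (d1 d2 : 'I_k.+1 -> 'Hom('Hom(V, R^o), V))
    (hdec : kronecker_decomposition c1 c2 n W d1 d2)
    (hn : forall i j : 'I_k.+1, (i < j)%N -> (n i < n j)%N) :
  let F := Phi c1 c2 in
  let L := pencil_core c1 c2 in
  let Lb j := pencil_core (d1 j) (d2 j) in
  [/\ forall i, (i <= n ord0)%N -> F i = F 0%N,
      forall j j' : 'I_k.+1, j' = j.+1 :> nat ->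
        forall i, (n j < i <= n j')%N -> F i = F (n j).+1,
      forall i, (n ord_max < i)%N -> F i = F (n ord_max).+1 &
      forall j, (F (n j).+1 <= F (n j))%VS /\ F (n j).+1 <> F (n j)] /\
  (forall j : 'I_k.+1,
     directv (\sum_(l < k.+1 | (l < j)%N) Lb l +
              \sum_(l < k.+1 | (j <= l)%N) W l) /\
     F (n j) = (\sum_(l < k.+1 | (l < j)%N) Lb l +
                \sum_(l < k.+1 | (j <= l)%N) W l)%VS) /\
  [/\ directv (\sum_(l < k.+1) Lb l),
      F (n ord_max).+1 = (\sum_(l < k.+1) Lb l)%VS &
      (\sum_(l < k.+1) Lb l)%VS = L] /\
  (* the numbers n j are invariants of J *)
  (forall (c1' c2' : 'Hom('Hom(V, R^o), V))
     (k' : nat) (n' : 'I_k' -> nat) (W' : 'I_k' -> {vspace V})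
     (d1' d2' : 'I_k' -> 'Hom('Hom(V, R^o), V)),
     c1' \in ext2 fullv -> c2' \in ext2 fullv ->
     range (pencil c1' c2') = range (pencil c1 c2) ->
     kronecker_decomposition c1' c2' n' W' d1' d2' ->
     perm_eq [seq n' j | j : 'I_k'] [seq n j | j : 'I_k.+1]).
Proof.
move=> F L Lb.
have n_mono (i j : 'I_k.+1) : (n i <= n j)%N = (i <= j)%N.
  have [ij|/hn|/val_inj->] := ltngtP i j; last by rewrite leqnn.
    exact/ltnW/hn.
  by rewrite ltnNge => /negPf.
have n_lt (i j : 'I_k.+1) : (n i < n j)%N = (i < j)%N by rewrite !ltnNge n_mono.
have FE i : F i = (\sum_j Phi_summand n W d1 d2 i j)%VS := Phi_sum hdec i.
have F_top i : (n ord_max < i)%N -> F i = (\sum_j Lb j)%VS.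
  move=> ni; rewrite FE; apply: eq_bigr => l _; rewrite /Phi_summand leqNgt.
  by rewrite (leq_ltn_trans _ ni) // n_mono -ltnS ltn_ord.
split; [split|split; [|split; [split|]]].
- move=> i ni; apply: (eq_Phi hdec) => l.
  by rewrite leq0n (leq_trans ni) // n_mono.
- move=> j j' jj' i /andP[ji ij']; apply: (eq_Phi hdec) => l.
  have [lj|jl] := leqP l j.
    rewrite ltnNge n_mono lj leqNgt; apply/negbTE; rewrite negbK.
    by rewrite (leq_ltn_trans _ ji) // n_mono.
  by rewrite n_lt jl (leq_trans ij') // n_mono jj'.
- by move=> i ni; rewrite !F_top.
- move=> j; split; first exact: (Phi_decr _ hdec).
  move=> E; have := dim_Phi_step hdec (n j); rewrite [Phi _ _ _.+1]E.
  move/eqP; rewrite -[X in X == _]addn0 eqn_add2l eq_sym muln_eq0 orbF => /eqP.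
  by move/card0_eq/(_ j); rewrite !inE eqxx.
- move=> j.
  have stepE l : Phi_summand n W d1 d2 (n j) l = if (l < j)%N then Lb l else W l.
    by rewrite /Phi_summand n_mono leqNgt; case: ltnP.
  have FjE : F (n j) = (\sum_(l < k.+1 | (l < j)%N) Lb l +
                        \sum_(l < k.+1 | (j <= l)%N) W l)%VS.
    rewrite FE (bigID (fun l : 'I_k.+1 => l < j)%N) /=; congr (_ + _)%VS.
      by apply: eq_bigr => l lj; rewrite stepE lj.
    by apply: eq_big => [l|l /negPf lj]; rewrite -?leqNgt // stepE lj.
  split=> //; rewrite directvE /= -FjE FE (directvP (Phi_summand_directv hdec _)) /=.
  apply/eqP; rewrite (bigID (fun l : 'I_k.+1 => l < j)%N) /=; congr (_ + _)%N.
    by apply: eq_bigr => l lj; rewrite stepE lj.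
  by apply: eq_big => [l|l /negPf lj]; rewrite -?leqNgt // stepE lj.
- by apply: directv_sum_subv (core_subv hdec) _; case: hdec => -[].
- exact: F_top.
- by rewrite -(core_sum hdec).
move=> c1' c2' k' n' W' d1' d2' _ _ rE dec'.
apply: perm_eq_codom_card => x.
have := dim_Phi_step dec' x; rewrite !(Phi_range _ hdec dec' rE).
rewrite (dim_Phi_step hdec x) => /eqP; rewrite eqn_add2l eqn_pmul2r // => /eqP.
by move->.
Qed.
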